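(* For every $n$ and every $n$-vertex tree $T$, there is a 3-hop routing scheme in the fixed-port model for the metric $M_T$ induced by $T$ with stretch 1 that uses $O(\log^2 n/\log\log n)$ bits per vertex.
   Context: A routing scheme for a metric $M$ on point set $V$ first chooses an overlay network (a graph on $V$ with edges weighted by metric distances) and assigns each vertex a routing table and a label (labeled model). A packet from source $s$ to destination $v$ carries a header containing the label of $v$ (possibly with extra information); at each vertex $u$, the routing algorithm uses only $u$'s routing table and the header to choose the outgoing edge, given by a port number. In the fixed-port model port numbers at each vertex are assigned adversarially. The scheme has stretch $t$ if the routed path between every pair has length at most $t$ times their distance, and is $k$-hop if every routed path uses at most $k$ edges. Memory per vertex counts the bits of its routing table and label. $M_T$ is the shortest-path metric of $T$ on its vertex set. *)

(* Defs.v *)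
From HB Require Import structures.
From mathcomp Require Import all_boot all_order all_algebra.
From mathcomp Require Import all_classical all_reals all_analysis.
Import Order.TTheory GRing.Theory Num.Theory.
Import numFieldNormedType.Exports.

Set Implicit Arguments.
Unset Strict Implicit.
Unset Printing Implicit Defensive.

Local Open Scope classical_set_scope.
Local Open Scope ring_scope.

Definition simple_graph (V : finType) (e : rel V) : Prop :=
  symmetric e /\ irreflexive e.

(* An e-cycle of length 2 is an edge traversed back and forth, hence the
   bound on the size of c. *)
Definition is_tree (V : finType) (e : rel V) : Prop :=
  [/\ (0 < #|V|)%N, simple_graph e, (forall x y, connect e x y)
    & forall c : seq V, ucycle e c -> (size c <= 2)%N].

Definition edge_weighting (R : realType) (V : finType) (e : rel V)
    (w : V -> V -> R) : Prop :=
  forall x y, e x y -> 0 < w x y /\ w x y = w y x.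

(* The walk u :: p is given, as in path.v, by its origin u and the
   sequence p of its other vertices; it has size p edges. *)
Definition walk_length (R : realType) (V : finType) (w : V -> V -> R)
    (u : V) (p : seq V) : R :=
  \sum_(l <- pairmap w u p) l.

Definition sp_metric (R : realType) (V : finType) (e : rel V)
    (w : V -> V -> R) (u v : V) : R :=
  inf [set walk_length w u p | p in [set p | path e u p /\ last u p = v]].

Definition bits := seq bool.

Record header := Header { dest_label : bits; extra_info : bits }.

(* The algorithm run by every vertex, on bit strings only.  [make_extra t l]
   is what a source with routing table t adds to the header of a packet whose
   destination has label l, and [forward t h] is the port on which a vertex
   with routing table t sends a packet with header h, or None when the packet
   has reached its destination.  It must be fixed before the tree is known:
   otherwise it could contain the whole tree, and tables made of vertex names
   would suffice. *)
Record routing_algorithm := RoutingAlgorithm {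
  make_extra : bits -> bits -> bits;
  forward : bits -> header -> option nat }.

(* port u v is the number at u of the edge uv; the ports of u are numbered
   from 1 to the degree of u in the overlay network. *)
Definition port_assignment (V : finType) (G : rel V) (port : V -> V -> nat)
    : Prop :=
  forall u, {in G u &, injective (port u)} /\
            {in G u, forall v, (1 <= port u v <= #|G u|)%N}.

(* As ports are distinct at each vertex, there is at most one such p. *)
Definition routed_path (A : routing_algorithm) (V : finType) (G : rel V)
    (port : V -> V -> nat) (table label : V -> bits) (s v : V) (p : seq V)
    : Prop :=
  let h := Header (label v) (make_extra A (table s) (label v)) in
  [/\ path (fun x y => G x y && (forward A (table x) h == Some (port x y))) s p,
      last s p = v
    & forward A (table v) h = None].

(* In the fixed-port model the ports are assigned once the overlay network G
   is chosen, and the tables and labels may depend on them. *)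
Definition fixed_port_routing (A : routing_algorithm) (R : realType)
    (V : finType) (d : V -> V -> R) (k : nat) (t : R) (b : nat) : Prop :=
  exists2 G : rel V, simple_graph G &
    forall port : V -> V -> nat, port_assignment G port ->
      exists table label : V -> bits,
        (forall u, (size (table u) + size (label u) <= b)%N) /\
        (forall s v, exists p : seq V,
           [/\ routed_path A G port table label s v p,
               (size p <= k)%N
             & walk_length d s p <= t * d s v]).

(* Main.v *)
Require Import Defs.
From HB Require Import structures.
From mathcomp Require Import all_boot all_order all_algebra.
From mathcomp Require Import all_classical all_reals all_analysis.
From mathcomp Require Import zify ring lra.
Import Order.TTheory GRing.Theory Num.Theory.
Import numFieldNormedType.Exports.

Set Implicit Arguments.
Unset Strict Implicit.
Unset Printing Implicit Defensive.

(* Number the vertices of the rooted tree in preorder and let X_i be the closure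
   under lowest common ancestors of the vertices whose number is a multiple of
   k^(d-i), where k is about the square root of log n, so that d is O(log n /
   log log n) and X_d contains every vertex.  Closure under lca makes every
   component of T - X_i adjacent to at most two vertices of X_i, one above it
   and one below it, and its preorder numbers form at most two intervals, so
   that it contains O(k) vertices of X_(i+1).  For the first i such that X_i
   separates u from v, the packet goes from u to the vertex x of X_i where the
   tree path leaves the component of u, then to the vertex y of X_i where it
   enters the component of v, then to v.  Thus u stores two ports and the label
   of v two ports for each i, and x, which enters the skeletons at level i only,
   stores its ports to the O(k) vertices of X_i that lie in its component of
   T - X_(i-1).  The overlay network is the complete graph. *)

(** * Codes of vertices, ancestors and preorder *)

Section Lcp.
Variable T : eqType.
Implicit Types s t u : seq T.

Fixpoint lcp s t : seq T :=
  match s, t with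
  | x :: s', y :: t' => if x == y then x :: lcp s' t' else [::]
  | _, _ => [::]
  end.

Lemma prefix_lcp u s t : prefix u (lcp s t) = prefix u s && prefix u t.
Proof.
elim: s t u => [|x s IH] [|y t] [|z u] //=; rewrite ?prefix0s ?andbF //.
case: (eqVneq x y) => [->|xy] /=; rewrite ?andbF.
  by rewrite IH; case: (z == y).
by case: (eqVneq z x) => [->|//] /=; rewrite (negbTE xy) andbF.
Qed.

Lemma lcp_cat s t s' t' :
  ~~ prefix s t -> ~~ prefix t s -> lcp (s ++ s') (t ++ t') = lcp s t.
Proof.
elim: s t => [|x s IH] [|y t] //=.
rewrite [y == x]eq_sym; case: (eqVneq x y) => //= _ h1 h2.
by rewrite IH.
Qed.

Lemma prefix_comparable s t u :
  prefix s u -> prefix t u -> size s <= size t -> prefix s t.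
Proof.
move=> /prefixP[s' ->] /prefixP[t' e] le; rewrite prefixE.
have := congr1 (take (size s)) e.
by rewrite take_size_cat // takel_cat // => {2}->.
Qed.

End Lcp.

Section LexOrder.
Implicit Types s t u : seqlexi nat.

Lemma prefix_lexi s t : prefix s t -> (s <= t)%O.
Proof.
elim: s t => [|x s IH] [|y t] //=.
by case/andP => /eqP -> /IH h; rewrite lexi_cons lexx /=.
Qed.

(** The extensions of [s] are convex in the lexicographic order; this makes every subtree an
    interval in preorder. *)
Lemma lexi_prefix s t u : prefix s u -> (s <= t)%O -> (t <= u)%O -> prefix s t.
Proof.
elim: s t u => [|x s IH] [|y t] [|z u] //=.
case/andP => /eqP <- su; rewrite !lexi_cons => /andP[xy h1] /andP[yx].
move: h1; rewrite xy yx /= => st tu; apply/andP; split.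
  by rewrite eq_le xy yx.
exact: IH su st tu.
Qed.

End LexOrder.

Section Trie.
Variables (V : finType) (c : V -> seq nat).
Hypothesis c_inj : injective c.
Hypothesis c_take : forall v i, exists u, c u = take i (c v).

Definition anc x y := prefix (c x) (c y).

(** As codes are closed under prefixes ([c_take]), this is the ancestor of [v] at depth [i], or [v]
    itself when [i] is too large. *)
Definition upto i v := odflt v [pick u | c u == take i (c v)].

Lemma uptoE i v : c (upto i v) = take i (c v).
Proof.
rewrite /upto; case: pickP => [u /eqP //|no].
by have [u /eqP] := c_take v i; rewrite no.
Qed.

Definition lca x y := upto (size (lcp (c x) (c y))) x.

Lemma lcaE x y : c (lca x y) = lcp (c x) (c y).
Proof.
rewrite uptoE; apply/eqP; rewrite -prefixE.
by have := prefix_refl (lcp (c x) (c y)); rewrite prefix_lcp => /andP[].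
Qed.

Lemma anc_refl x : anc x x. Proof. exact: prefix_refl. Qed.

Lemma anc_trans y x z : anc x y -> anc y z -> anc x z.
Proof. exact: prefix_trans. Qed.

Lemma anc_anti x y : anc x y -> anc y x -> x = y.
Proof.
move=> xy yx; apply: c_inj; move: (xy); rewrite /anc prefixE => /eqP <-.
by apply: take_oversize; exact: size_prefix.
Qed.

Lemma anc_size x y : anc x y -> size (c x) <= size (c y).
Proof. exact: size_prefix. Qed.

Lemma anc_size_eq x y : anc x y -> size (c y) <= size (c x) -> x = y.
Proof.
move=> xy h; apply: anc_anti => //.
by apply: (prefix_comparable (prefix_refl _) xy).
Qed.

Lemma anc_comparable x y z :
  anc x z -> anc y z -> size (c x) <= size (c y) -> anc x y.
Proof. exact: prefix_comparable. Qed.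

Lemma anc_total x y z : anc x z -> anc y z -> anc x y || anc y x.
Proof.
move=> xz yz; have [h|/ltnW h] := leqP (size (c x)) (size (c y)).
  by rewrite (anc_comparable xz yz h).
by rewrite (anc_comparable yz xz h) orbT.
Qed.

Lemma anc_lca z x y : anc z (lca x y) = anc z x && anc z y.
Proof. by rewrite /anc lcaE prefix_lcp. Qed.

Lemma lca_ancl x y : anc (lca x y) x.
Proof. by have := anc_refl (lca x y); rewrite anc_lca => /andP[]. Qed.

Lemma lca_ancr x y : anc (lca x y) y.
Proof. by have := anc_refl (lca x y); rewrite anc_lca => /andP[]. Qed.

Lemma lca_unique z x y :
  anc z x -> anc z y -> (forall w, anc w x -> anc w y -> anc w z) ->
  lca x y = z.
Proof.
move=> zx zy h; apply: anc_anti; last by rewrite anc_lca zx.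
by apply: h; [exact: lca_ancl|exact: lca_ancr].
Qed.

Lemma lcaxx x : lca x x = x.
Proof. exact: lca_unique (anc_refl x) (anc_refl x) (fun _ h _ => h). Qed.

Lemma lcaC x y : lca x y = lca y x.
Proof.
by apply: lca_unique (lca_ancr _ _) (lca_ancl _ _) _ => w wx wy;
  rewrite anc_lca wx wy.
Qed.

Lemma lca_anc x y : anc x y -> lca x y = x.
Proof. by move=> xy; apply: lca_unique (anc_refl x) xy (fun _ h _ => h). Qed.

Lemma lca_incomparable x y x' y' :
  anc x x' -> anc y y' -> ~~ anc x y -> ~~ anc y x -> lca x' y' = lca x y.
Proof.
move=> /prefixP[s ex] /prefixP[t ey] xy yx; apply: c_inj.
by rewrite !lcaE ex ey lcp_cat.
Qed.

Lemma anc_upto i v : anc (upto i v) v.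
Proof. by rewrite /anc uptoE prefix_take. Qed.

(** The rank of the code is the preorder number, because a prefix precedes its extensions. *)
Definition pre v := #|[set x : V | ((c x : seqlexi nat) < c v)%O]|.

Lemma pre_lt n v : #|V| = n -> pre v < n.
Proof.
move=> <-; rewrite -cardsT; apply: proper_card; rewrite properE finset.subsetT.
by apply/fintype.subsetPn; exists v; rewrite ?inE // ltxx.
Qed.

Lemma leq_pre x y : (pre x <= pre y) = ((c x : seqlexi nat) <= c y)%O.
Proof.
have mono u v : ((c u : seqlexi nat) <= c v)%O -> pre u <= pre v.
  move=> uv; apply: subset_leq_card; apply/fintype.subsetP => z.
  by rewrite !inE => /lt_le_trans; apply.
apply/idP/idP => [h|/mono //]; case: leP => // yx.
suff: pre y < pre x by rewrite ltnNge h.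
apply: proper_card; rewrite properE; apply/andP; split.
  by apply/fintype.subsetP => z; rewrite !inE => /lt_trans; apply.
by apply/fintype.subsetPn; exists y; rewrite !inE ?ltxx.
Qed.

Lemma pre_inj : injective pre.
Proof.
move=> x y exy; apply: c_inj; apply/eqP.
by rewrite -[_ == _]/((c x : seqlexi nat) == c y) eq_le -!leq_pre exy leqnn.
Qed.

Lemma pre_surj m : m < #|V| -> exists v, pre v = m.
Proof.
move=> mV; pose f v := Ordinal (pre_lt v (erefl #|V|)).
have f_inj : injective f by move=> x y /(congr1 val) /= /pre_inj.
have /(inj_card_onto f_inj) h : #|'I_#|V| | <= #|V| by rewrite card_ord.
have /codomP[v e] := h (Ordinal mV).
by exists v; rewrite -[RHS]/(val (Ordinal mV)) e.
Qed.

Lemma anc_pre x y : anc x y -> pre x <= pre y.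
Proof. by move=> xy; rewrite leq_pre; apply: prefix_lexi. Qed.

Lemma anc_convex x y z :
  anc x z -> pre x <= pre y -> pre y <= pre z -> anc x y.
Proof. by rewrite !leq_pre; apply: lexi_prefix. Qed.

Definition lastpre x := \max_(y | anc x y) pre y.

(** Descent becomes a comparison of three numbers, which a router can perform. *)
Lemma anc_interval x y : anc x y = (pre x <= pre y <= lastpre x).
Proof.
apply/idP/andP => [xy|[h1 h2]].
  by split; [exact: anc_pre|exact: leq_bigmax_cond].
have [z xz e] : {z | anc x z & lastpre x = pre z}.
  by apply: eq_bigmax_cond; apply/card_gt0P; exists x; exact: anc_refl.
by apply: anc_convex xz h1 _; rewrite -e.
Qed.

End Trie.

(** * Separation and skeletons *)

Section Separation.
Variables (V : finType) (c : V -> seq nat) (e : rel V).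
Hypothesis c_inj : injective c.
Hypothesis c_take : forall v i, exists u, c u = take i (c v).
Hypothesis c_edge : forall x y, e x y ->
  (exists a, c y = rcons (c x) a) \/ (exists a, c x = rcons (c y) a).

(** The tree path climbs from [u] to the lca, then goes down to [v]. *)
Definition between u x v := anc c (lca c u v) x && (anc c x u || anc c x v).

Lemma between_sym u x v : between u x v = between v x u.
Proof. by rewrite /between orbC (lcaC c_inj c_take). Qed.

Lemma prefix_rconsE (s t : seq nat) a :
  prefix s (rcons t a) = prefix s t || (s == rcons t a).
Proof.
elim: t s => [|y t IH] [|x s] //=; rewrite eqseq_cons ?prefixs0 //.
by rewrite IH; case: (x == y).
Qed.

Lemma exit_edge x y z : e y z -> anc c x y -> ~~ anc c x z -> x = y.
Proof.
move=> /c_edge[] [a ea] xy nxz.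
  case/negP: nxz; rewrite /anc ea prefix_rconsE.
  by rewrite -[prefix (c x) (c y)]/(anc c x y) xy.
move: xy; rewrite /anc ea prefix_rconsE -ea.
by rewrite -[prefix _ _]/(anc c x z) (negbTE nxz) => /eqP/c_inj.
Qed.

Lemma exit_walk x u p :
  path e u p -> anc c x u -> ~~ anc c x (last u p) -> x \in u :: p.
Proof.
elim: p u => [|z p IH] u /=; first by move=> _ ->.
case/andP=> uz zp xu nx; have [xz|nxz] := boolP (anc c x z).
  by rewrite inE IH ?orbT.
by rewrite (exit_edge uz xu nxz) mem_head.
Qed.

Lemma entry_edge x y z : e y z -> ~~ anc c x y -> anc c x z -> x = z.
Proof.
move=> /c_edge[] [a ea] nxy xz; last first.
  case/negP: nxy; rewrite /anc ea prefix_rconsE.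
  by rewrite -[prefix (c x) (c z)]/(anc c x z) xz.
move: xz; rewrite /anc ea prefix_rconsE -ea.
by rewrite -[prefix _ _]/(anc c x y) (negbTE nxy) => /eqP/c_inj.
Qed.

Lemma entry_walk x u p :
  path e u p -> ~~ anc c x u -> anc c x (last u p) -> x \in u :: p.
Proof.
elim: p u => [|z p IH] u /=; first by move=> _ /negbTE ->.
case/andP=> uz zp xu nx; have [xz|nxz] := boolP (anc c x z).
  by rewrite (entry_edge uz xu xz) !inE eqxx orbT.
by rewrite inE IH ?orbT.
Qed.

(** Each edge joins a parent and a child. If the apex of the tail is not above [u], the first step
    goes down from [u] to that apex, and [u] replaces it. *)
Lemma walk_apex u p :
  path e u p -> exists2 w, w \in u :: p & {in u :: p, forall y, anc c w y}.
Proof.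
elim: p u => [|z p IH] u /=.
  exists u; first exact: mem_head.
  by move=> y; rewrite inE => /eqP ->; exact: anc_refl.
case/andP=> uz /IH[w wp h]; have wz := h z (mem_head _ _).
have [wu|nwu] := boolP (anc c w u).
  exists w; first by rewrite inE wp orbT.
  by move=> y; rewrite inE => /predU1P[->|/h].
exists u; first exact: mem_head.
have ez := entry_edge uz nwu wz.
have uz' : anc c u z.
  case: (c_edge uz) => -[a ea]; first by rewrite /anc ea prefix_rcons.
  by case/negP: nwu; rewrite ez /anc ea prefix_rcons.
move=> y; rewrite inE => /predU1P[->|/h]; first exact: anc_refl.
by apply: anc_trans; rewrite ez.
Qed.

(** The apex of the walk is above both ends, hence above [x]. Unless it is [x], it is outside the
    subtree of [x], which the walk leaves before the apex or enters after it; both happen at [x]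
    only. *)
Lemma between_walk u x p :
  path e u p -> between u x (last u p) -> x \in u :: p.
Proof.
move=> up /andP[lx xuv]; have [w wp hw] := walk_apex up.
have wx : anc c w x.
  apply: (anc_trans _ lx); rewrite (anc_lca c_take) hw ?mem_head //.
  by rewrite hw // mem_last.
have [xw|nxw] := boolP (anc c x w); first by rewrite (anc_anti c_inj xw wx).
have [wu|nwu] := eqVneq w u; first subst w.
  case/orP: xuv => xv; first by rewrite xv in nxw.
  exact: entry_walk.
have {}wp : w \in p by move: wp; rewrite inE (negbTE nwu).
have [p1 [p2 ep]] : exists p1 p2, p = rcons p1 w ++ p2.
  by case/path.splitP: wp => p1 p2; exists p1, p2.
move: up lx xuv hw; rewrite {}ep.
rewrite cat_path last_rcons last_cat last_rcons => /andP[up1 wp2] lx xuv hw.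
rewrite -cat_cons mem_cat; case/orP: xuv => [xu|xv].
  by rewrite exit_walk ?last_rcons.
by have := entry_walk wp2 nxw xv; rewrite inE => /predU1P[->|->];
  rewrite ?orbT // -rcons_cons mem_rcons mem_head.
Qed.

End Separation.

(** * Components of the tree minus a skeleton *)

Section Skeleton.
Variables (V : finType) (c : V -> seq nat) (root : V).
Hypothesis c_inj : injective c.
Hypothesis c_take : forall v i, exists u, c u = take i (c v).
Hypothesis c_root : c root = [::].

Local Notation depth x := (size (c x)).

Lemma anc_root x : anc c root x.
Proof. by rewrite /anc c_root prefix0s. Qed.

Definition skeleton (X : {set V}) :=
  root \in X /\ {in X &, forall x y, lca c x y \in X}.

(* Deleting X leaves a forest: [top X u] is the root of the component of u,
   [gate X u] the vertex of X above this component, [bot X u] the one below it,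
   if any, and [exit X u t] the vertex of X where the path from u to a vertex t
   of another component leaves it.  When u is in X, they are all u. *)
Definition gate (X : {set V}) u :=
  [arg max_(x > root | (x \in X) && anc c x u) depth x].

Definition top (X : {set V}) u := upto c (depth (gate X u)).+1 u.

Definition bot (X : {set V}) u :=
  [pick b | [&& b \in X, anc c (top X u) b &
              [forall x in X, anc c (top X u) x ==> anc c b x]]].

Definition exit (X : {set V}) u t :=
  if bot X u is Some b then if anc c b t then b else gate X u else gate X u.

Variable X : {set V}.
Hypothesis X_skel : skeleton X.

Lemma gateP u :
  [/\ gate X u \in X, anc c (gate X u) u
    & forall x, x \in X -> anc c x u -> anc c x (gate X u)].
Proof.
rewrite /gate; case: arg_maxnP => [|x /andP[xX xu] hmax].
  by rewrite (proj1 X_skel) anc_root.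
split=> // y yX yu; apply: (anc_comparable yu xu).
by apply: hmax; rewrite yX yu.
Qed.

Lemma gate_mem u : gate X u \in X. Proof. by have [] := gateP u. Qed.

Lemma gate_anc u : anc c (gate X u) u. Proof. by have [] := gateP u. Qed.

Lemma gate_max u x : x \in X -> anc c x u -> anc c x (gate X u).
Proof. by have [_ _] := gateP u; apply. Qed.

Lemma gate_id u : u \in X -> gate X u = u.
Proof.
move=> uX; apply: (anc_anti c_inj (gate_anc u)).
exact: (gate_max uX (anc_refl _ _)).
Qed.

Lemma top_anc u : anc c (top X u) u. Proof. exact: anc_upto. Qed.

Lemma gate_top u : anc c (gate X u) (top X u).
Proof.
apply: (anc_comparable (gate_anc u) (top_anc u)).
rewrite /top (uptoE c_take) size_take.
by case: ltnP => // h; apply: (anc_size (gate_anc u)).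
Qed.

Lemma top_below u x : anc c x u -> ~~ anc c x (gate X u) -> anc c (top X u) x.
Proof.
move=> xu nx; apply: (anc_comparable (top_anc u) xu).
rewrite /top (uptoE c_take) size_take_min geq_min.
rewrite ltnNge; apply/orP; left; apply: contra nx => h.
exact: anc_comparable xu (gate_anc u) h.
Qed.

Lemma top_id u : u \in X -> top X u = u.
Proof.
move=> uX; apply: (anc_anti c_inj (top_anc u)).
by have := gate_top u; rewrite gate_id.
Qed.

Lemma top_mem u : anc c (top X u) (gate X u) -> u \in X.
Proof.
move=> h; suff <- : gate X u = u by exact: gate_mem.
apply: (anc_size_eq c_inj (gate_anc u)).
have := anc_size h; rewrite /top (uptoE c_take) size_take_min geq_min.
by rewrite ltnn.
Qed.

Lemma top_in_mem u : top X u \in X -> u \in X.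
Proof. by move=> h; apply: top_mem; apply: gate_max h (top_anc u). Qed.

Lemma skeleton_below u x :
  u \notin X -> x \in X -> anc c (top X u) x -> ~~ anc c x u.
Proof.
move=> uX xX ux; apply: contra uX => xu; apply: top_mem.
by apply: (anc_trans ux); apply: gate_max.
Qed.

Lemma depth_top u : u \notin X -> depth (top X u) = (depth (gate X u)).+1.
Proof.
move=> uX; rewrite /top (uptoE c_take) size_take_min; apply/minn_idPl.
rewrite ltnNge; apply: contra uX => h.
by rewrite -(anc_size_eq c_inj (gate_anc u) h) gate_mem.
Qed.

(** Both tops truncate the code of [t] just below the common gate. *)
Lemma top_eq u t :
  u \notin X -> gate X u = gate X t -> anc c (top X u) t -> top X u = top X t.
Proof.
move=> uX eg; rewrite /anc prefixE (depth_top uX) => /eqP h.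
by apply: c_inj; rewrite -h eg /top (uptoE c_take).
Qed.

Lemma top_mem_eq x y : x \in X -> top X x = top X y -> x = y.
Proof.
move=> xX e; have yX : y \in X by apply: top_in_mem; rewrite -e top_id.
by rewrite -(top_id xX) e top_id.
Qed.

Lemma bot_some u b : bot X u = Some b ->
  [/\ b \in X, anc c (top X u) b
    & {in X, forall x, anc c (top X u) x -> anc c b x}].
Proof.
rewrite /bot; case: pickP => // x /and3P[xX ux /forall_inP h] [<-].
by split=> // y yX uy; apply: (implyP (h y yX)).
Qed.

(** Closure under lca acts here: the lca of a shallowest [b] in [X] below the top with any other
    such vertex is again one, so it cannot be above [b] without being [b]. *)
Lemma bot_ex u x :
  x \in X -> anc c (top X u) x -> exists2 b, bot X u = Some b & anc c b x.
Proof.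
move=> xX ux; rewrite /bot; case: pickP => [b /and3P[_ _ /forall_inP h]|no].
  by exists b => //; apply: (implyP (h x xX)).
have [b /andP[bX ub] hmin] :=
  @arg_minnP _ x (fun y => (y \in X) && anc c (top X u) y) (fun y => depth y)
    (introT andP (conj xX ux)).
have /negP[] := negbT (no b); rewrite bX ub /=.
apply/forall_inP => y yX; apply/implyP => uy.
have bl : depth b <= depth (lca c b y).
  by apply: hmin; rewrite (proj2 X_skel) // (anc_lca c_take) ub uy.
rewrite -(anc_size_eq c_inj (lca_ancl c_take b y) bl).
exact: lca_ancr.
Qed.

(** The gate of [t] is strictly deeper than that of [u], since equal gates would give equal tops. It
    is thus a vertex of [X] below [top X u], hence below the bot. *)
Lemma leave_below u t :
  anc c (top X u) t -> top X u != top X t ->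
  exists2 b, bot X u = Some b & anc c b t.
Proof.
move=> ut net; have [uX|uX] := boolP (u \in X).
  have [b eb bu] := bot_ex uX (top_anc u).
  by exists b => //; apply: (anc_trans bu); rewrite -(top_id uX).
suff /(bot_ex (gate_mem t))[b eb bt] : anc c (top X u) (gate X t).
  by exists b => //; apply: (anc_trans bt (gate_anc t)).
apply: (anc_comparable ut (gate_anc t)); rewrite (depth_top uX).
have ggt : anc c (gate X u) (gate X t).
  by apply: (gate_max (gate_mem u) (anc_trans (gate_top u) ut)).
rewrite ltnNge; apply: contra net => h; apply/eqP; apply: top_eq => //.
exact: (anc_size_eq c_inj ggt h).
Qed.

Lemma exit_mem u t : exit X u t \in X.
Proof.
rewrite /exit; case eb: (bot X u) => [b|]; last exact: gate_mem.
by case: ifP => _; [have [] := bot_some eb | exact: gate_mem].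
Qed.

Lemma bot_id u b : u \in X -> bot X u = Some b -> b = u.
Proof.
move=> uX /bot_some[bX]; rewrite (top_id uX) => ub h.
by apply: (anc_anti c_inj _ ub); apply: (h _ uX (anc_refl _ _)).
Qed.

Lemma exit_id u t : u \in X -> exit X u t = u.
Proof.
move=> uX; rewrite /exit; case eb: (bot X u) => [b|]; last exact: gate_id.
by rewrite (bot_id uX eb) gate_id ?if_same.
Qed.

Lemma between_refll u t : between c u u t.
Proof. by rewrite /between anc_refl lca_ancl. Qed.

(** If the lca of [u] and [t] is not above the gate of [u], it is below [top X u], and [leave_below]
    makes the path go through the bot. *)
Lemma exit_between u t : top X u != top X t -> between c u (exit X u t) t.
Proof.
move=> net; have [uX|uX] := boolP (u \in X).
  by rewrite exit_id // between_refll.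
have lu := lca_ancl c_take u t; have lt := lca_ancr c_take u t.
have not_below : forall b, bot X u = Some b -> ~~ anc c b u.
  by move=> b /bot_some[bX ub _]; apply: skeleton_below.
rewrite /exit; case eb: (bot X u) => [b|].
  case: ifP => [bt|nbt]; rewrite /between.
    rewrite bt orbT andbT; case/orP: (anc_total lt bt) => // bl.
    by have /negP[] := not_below b eb; apply: (anc_trans bl lu).
  rewrite gate_anc andbT; apply: contraFT nbt => nl.
  have := leave_below (anc_trans (top_below lu nl) lt) net.
  by rewrite eb => -[_ [<-]].
rewrite /between gate_anc andbT; apply: contraT => nl.
by have [] := leave_below (anc_trans (top_below lu nl) lt) net; rewrite eb.
Qed.

(** The exit of [u] depends on its target only through whether the bot of [u] is above it, and
    replacing [t] by its own exit towards [u] preserves this. *)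
Lemma exit_exit u t : exit X u (exit X t u) = exit X u t.
Proof.
have [uX|uX] := boolP (u \in X); first by rewrite !(exit_id _ uX).
rewrite {1 3}/exit; case eb: (bot X u) => [b|] //.
suff -> : anc c b (exit X t u) = anc c b t by [].
have [bX ub hb] := bot_some eb.
have nbu : ~~ anc c b u by apply: skeleton_below.
rewrite /exit; case eb': (bot X t) => [b'|]; last first.
  by apply/idP/idP => [/anc_trans|]; [apply; exact: gate_anc | exact: gate_max].
case: ifP => b'u; last first.
  by apply/idP/idP => [/anc_trans|]; [apply; exact: gate_anc | exact: gate_max].
have [b'X tb' _] := bot_some eb'.
apply/idP/idP => [bb'|bt]; first by case/negP: nbu; apply: (anc_trans bb' b'u).
by apply: (anc_trans _ tb'); apply: (anc_trans _ (gate_top t)); apply: gate_max.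
Qed.

(** If the path left the component, some vertex of [X] below the top would be above one of its ends,
    against [skeleton_below]. *)
Lemma between_exit_top u x t :
  u != t -> top X u = top X t -> between c u x t -> top X x = top X u.
Proof.
move=> nut eut /andP[lx xut].
have uX : u \notin X by apply: contraNN nut => uX; apply/eqP/top_mem_eq.
have ux : anc c (top X u) x.
  by apply: (anc_trans _ lx); rewrite (anc_lca c_take) top_anc eut top_anc.
have below z : top X z = top X u -> anc c x z -> top X x = top X u.
  move=> ez xz; apply/esym; apply: top_eq => //.
  apply: (anc_anti c_inj); apply: (gate_max (gate_mem _)).
    exact: anc_trans (gate_top u) ux.
  apply: contraT => ngu; have gu := anc_trans (gate_anc x) xz.
  have uz : anc c (top X u) z by rewrite -ez top_anc.
  have ntg : ~~ anc c (top X u) (gate X x).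
    apply/negP => h; have [b eb bg] := bot_ex (gate_mem x) h.
    have [bX ub _] := bot_some eb.
    have zX : z \notin X.
      by apply: contra uX => zX; rewrite -(top_mem_eq zX ez).
    have /negP[] := skeleton_below zX bX (eq_ind_r (fun r => anc c r b) ub ez).
    exact: anc_trans bg gu.
  case/orP: (anc_total ux (gate_anc x)) => [/(negP ntg) //|gt].
  by case/negP: ngu; apply: (anc_trans gt (top_anc u)).
by case/orP: xut => h; [apply: (below u _ h) | apply: (below t _ h)].
Qed.

End Skeleton.

(** * Closure under lowest common ancestors *)

Section Closure.
Variables (V : finType) (c : V -> seq nat) (root : V).
Hypothesis c_inj : injective c.
Hypothesis c_take : forall v i, exists u, c u = take i (c v).
Hypothesis c_root : c root = [::].

Local Notation depth x := (size (c x)).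

Definition lca_closure (A : {set V}) := [set lca c y z | y in A, z in A].

Implicit Types A B : {set V}.

Lemma mem_lca_closure A y z :
  y \in A -> z \in A -> lca c y z \in lca_closure A.
Proof. by move=> yA zA; apply/imset2P; exists y z. Qed.

Lemma sub_lca_closure A : {subset A <= lca_closure A}.
Proof. by move=> y yA; rewrite -(lcaxx c_inj c_take y) mem_lca_closure. Qed.

Lemma lca_closureS A B : A \subset B -> {subset lca_closure A <= lca_closure B}.
Proof.
move=> /fintype.subsetP AB _ /imset2P[y z yA zA ->].
by apply: mem_lca_closure; apply: AB.
Qed.

(** One round of lcas suffices: if the lcas of [y], [z] and of [y'], [z'] are incomparable, their
    lca is that of [y] and [y']. *)
Lemma lca_closure_skeleton A : root \in A -> skeleton c root (lca_closure A).
Proof.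
move=> rA; split; first exact: sub_lca_closure.
move=> x x' xA x'A; have [xx'|nxx'] := boolP (anc c x x').
  by rewrite (lca_anc c_inj c_take xx').
have [x'x|nx'x] := boolP (anc c x' x).
  by rewrite (lcaC c_inj c_take) (lca_anc c_inj c_take x'x).
case/imset2P: xA nxx' nx'x => y z yA zA ->.
case/imset2P: x'A => y' z' y'A z'A -> n1 n2.
rewrite -(lca_incomparable c_inj c_take (lca_ancl c_take y z)
  (lca_ancl c_take y' z') n1 n2).
exact: mem_lca_closure.
Qed.

(* Adding w creates at most one vertex besides w: the deepest lca x0 of w with
   an older vertex y0.  A higher lca of w and z is also the lca of y0 and z. *)
Lemma card_lca_closure A : #|lca_closure A| <= #|A|.*2.
Proof.
move: {2}#|A| (leqnn #|A|) => n; elim: n A => [|n IH] A.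
  rewrite leqn0 => /eqP A0.
  suff -> : lca_closure A = finset.set0 by rewrite cards0.
  apply/eqP; rewrite -finset.subset0; apply/fintype.subsetP => x /imset2P[y z].
  by rewrite (cards0_eq A0) inE.
have [->|[w wA] An] := set_0Vmem A.
  by move=> _; apply: IH; rewrite cards0.
have An' : #|A :\ w| <= n by move: An; rewrite (cardsD1 w) wA.
have [x0 sub] : exists x0,
    lca_closure A \subset w |: (x0 |: lca_closure (A :\ w)).
  have [A0|[y yA']] := set_0Vmem (A :\ w).
    exists w; apply/fintype.subsetP => _ /imset2P[y z yA zA ->].
    have one t : t \in A -> t = w.
      move=> tA; apply/eqP; apply: contraT => tw.
      have : t \in A :\ w by rewrite !inE tw.
      by rewrite A0 inE.
    by rewrite (one y yA) (one z zA) (lcaxx c_inj c_take) !inE eqxx.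
  have [y0 y0A hmax] :=
    @arg_maxnP _ y (mem (A :\ w)) (fun y => depth (lca c w y)) yA'.
  exists (lca c w y0); have main z : z \in A :\ w ->
      lca c w z \in w |: (lca c w y0 |: lca_closure (A :\ w)).
    move=> zA; rewrite !inE; apply/orP; right.
    have [le|lt] := leqP (depth (lca c w y0)) (depth (lca c w z)).
      apply/orP; left; rewrite eq_sym; apply/eqP; apply: (anc_size_eq c_inj).
        exact: (anc_comparable (lca_ancl c_take _ _) (lca_ancl c_take _ _)).
      exact: hmax.
    apply/orP; right.
    suff <- : lca c y0 z = lca c w z by apply: mem_lca_closure.
    have h : anc c (lca c w z) (lca c w y0).
      apply: (anc_comparable (lca_ancl c_take _ _) (lca_ancl c_take _ _)).
      exact: ltnW.
    apply: (lca_unique c_inj c_take).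
    - exact: (anc_trans h (lca_ancr c_take _ _)).
    - exact: lca_ancr.
    move=> t ty0 tz; rewrite (anc_lca c_take) tz andbT.
    case/orP: (anc_total ty0 (lca_ancr c_take w y0)) => [t0|t0].
      exact: (anc_trans t0 (lca_ancl c_take _ _)).
    suff /anc_size : anc c (lca c w y0) (lca c w z) by rewrite leqNgt lt.
    by rewrite (anc_lca c_take) (lca_ancl c_take) (anc_trans t0 tz).
  apply/fintype.subsetP => _ /imset2P[u z uA zA ->].
  have [->|uw] := eqVneq u w; have [->|zw] := eqVneq z w.
  - by rewrite (lcaxx c_inj c_take) !inE eqxx.
  - by apply: main; rewrite !inE zw.
  - by rewrite (lcaC c_inj c_take); apply: main; rewrite !inE uw.
  by rewrite !finset.in_setU mem_lca_closure ?orbT // !inE ?uw ?zw.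
apply: leq_trans (subset_leq_card sub) _.
apply: leq_trans (leq_card_setU _ _) _.
rewrite cards1; apply: leq_trans (leq_add (leqnn 1) (leq_card_setU _ _)) _.
rewrite cards1 [#|A|](cardsD1 w) wA /= doubleD.
by rewrite addnA leq_add2l; apply: IH.
Qed.

(** * New skeleton vertices inside one component *)

Variable Y : {set V}.
Hypothesis Y_skel : skeleton c root Y.
Variable a : V.
Hypothesis aY : a \notin Y.

Definition component := [set x | top c root Y x == top c root Y a].

Lemma component_top x : x \in component -> anc c (top c root Y a) x.
Proof. by rewrite inE => /eqP <-; apply: top_anc. Qed.

Lemma bot_component b x :
  bot c root Y a = Some b -> x \in component -> ~~ anc c b x.
Proof.
move=> /(bot_some)[bY ab _]; rewrite inE => /eqP ex.
apply: (skeleton_below c_inj c_take c_root Y_skel _ bY); last by rewrite ex.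
apply: contra aY => xY.
by rewrite -(top_mem_eq c_inj c_take c_root Y_skel xY ex).
Qed.

Lemma below_component y : anc c (top c root Y a) y -> y \notin component ->
  exists2 b, bot c root Y a = Some b & anc c b y.
Proof.
rewrite inE eq_sym => ay ny.
exact: (leave_below c_inj c_take c_root Y_skel ay).
Qed.

(** When an lca is in the component, at most one of its two arguments is outside. That argument is
    below the bot, and replacing it by the bot does not change the lca. *)
Lemma card_closure_component A :
  #|lca_closure A :&: component| <= (#|A :&: component|.+1).*2.
Proof.
pose B := if bot c root Y a is Some b then [set b] else finset.set0.
have sub : lca_closure A :&: component \subset
    lca_closure ((A :&: component) :|: B).
  apply/fintype.subsetP => x; rewrite inE => /andP[/imset2P[y z yA zA ex] xC].
  have ay : anc c (top c root Y a) y.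
    by apply: (anc_trans (component_top xC)); rewrite ex lca_ancl.
  have az : anc c (top c root Y a) z.
    by apply: (anc_trans (component_top xC)); rewrite ex lca_ancr.
  have half u v b : u \in A -> v \in A -> x = lca c u v -> u \in component ->
      bot c root Y a = Some b -> anc c b v ->
      x \in lca_closure ((A :&: component) :|: B).
    move=> uA vA exx uC eb bv.
    suff -> : x = lca c u b.
      by apply: mem_lca_closure; rewrite !inE ?uA; rewrite inE in uC;
        rewrite ?uC // /B eb inE eqxx orbT.
    have xb : anc c x b.
      have xv : anc c x v by rewrite exx lca_ancr.
      case/orP: (anc_total xv bv) => // bx.
      by have := bot_component eb xC; rewrite bx.
    apply/esym; apply: (lca_unique c_inj c_take) => //.
      by rewrite exx lca_ancl.
    move=> t tu tb; rewrite exx (anc_lca c_take) tu.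
    exact: (anc_trans tb bv).
  have [yC|nyC] := boolP (y \in component).
    have [zC|nzC] := boolP (z \in component).
      rewrite ex; apply: mem_lca_closure; rewrite finset.in_setU finset.in_setI.
        by rewrite yA yC.
      by rewrite zA zC.
    have [b eb bz] := below_component az nzC.
    exact: (half y z b).
  have [b eb bY] := below_component ay nyC.
  have [zC|nzC] := boolP (z \in component).
    by apply: (half z y b) => //; rewrite (lcaC c_inj c_take).
  have [b' ] := below_component az nzC; rewrite eb => -[<-] bz.
  have /negP[] := bot_component eb xC.
  by rewrite ex (anc_lca c_take) bY bz.
apply: leq_trans (subset_leq_card sub) _.
apply: leq_trans (card_lca_closure _) _; rewrite leq_double.
apply: leq_trans (leq_card_setU _ _) _; rewrite -addn1 leq_add2l /B.
by case: (bot _ _ _ _) => [b|]; rewrite ?cards1 ?cards0.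
Qed.

Definition multiples m := [set y | m %| pre c y].

(* The preorder numbers of the component form two intervals, before and after
   the vertices below it, and neither contains a multiple of k * m. *)
Lemma card_multiples_component k m : 0 < k -> multiples (k * m) \subset Y ->
  #|multiples m :&: component| <= k.*2.
Proof.
move=> k0 /fintype.subsetP subY.
pose side y := if bot c root Y a is Some b then pre c y < pre c b else true.
have same y y' : y \in component -> y' \in component -> side y = side y' ->
    pre c y <= pre c y' -> pre c y %/ (k * m) = pre c y' %/ (k * m).
  move=> yC y'C es le; apply/eqP; rewrite eqn_leq leq_div2r //= leqNgt.
  apply/negP => lt.
  have [km0|km0] := posnP (k * m); first by rewrite km0 !divn0 in lt.
  (* If the quotients differed, the vertex [v] numbered [q] would be in [Y], in the subtree but
     outside the component, hence below the bot [b]. Then [y'] comes after [b], so does [y] as it is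
     on the same side, and by convexity [y] is below [b], which is impossible. *)
  pose q := pre c y' %/ (k * m) * (k * m).
  have qy' : q <= pre c y' by exact: leq_divM.
  have yq : pre c y <= q.
    apply: ltnW; rewrite (leq_trans (ltn_ceil _ km0)) //.
    by rewrite leq_mul2r lt orbT.
  have [v ev] : exists v, pre c v = q.
    apply: (pre_surj c_inj); apply: leq_ltn_trans qy' _.
    exact: pre_lt.
  have vY : v \in Y by apply: subY; rewrite inE ev dvdn_mull.
  have av : anc c (top c root Y a) v.
    apply: (anc_convex (component_top y'C)); rewrite ev //.
    exact: leq_trans (anc_pre (component_top yC)) yq.
  have nvC : v \notin component.
    rewrite inE; apply: contra aY => /eqP evt.
    by rewrite -(top_mem_eq c_inj c_take c_root Y_skel vY evt).
  have [b eb bv] := below_component av nvC.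
  have := anc_pre bv; rewrite ev => bq.
  move: es; rewrite /side eb.
  have -> : (pre c y' < pre c b) = false.
    by apply/negbTE; rewrite -leqNgt (leq_trans bq).
  move/negbT; rewrite -leqNgt => by_.
  have /negP[] := bot_component eb yC.
  by apply: (anc_convex bv) => //; rewrite ev.
(* The side determines the quotient of the number by [k * m]; the remaining digit has [k] values. *)
pose f y := (side y, Ordinal (ltn_pmod (pre c y %/ m) k0)).
have -> : k.*2 = #|{: bool * 'I_k}|.
  by rewrite card_prod card_bool card_ord mul2n.
rewrite -(card_in_imset (f := f)); first exact: max_card.
have winj y y' : y \in multiples m :&: component ->
    y' \in multiples m :&: component -> f y = f y' ->
    pre c y <= pre c y' -> y = y'.
  rewrite inE => /andP[my yC]; rewrite inE => /andP[my' y'C] [es /= er] le.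
  apply: (pre_inj c_inj); move: my my'; rewrite !inE => /divnK <- /divnK <-.
  congr (_ * m); rewrite (divn_eq (pre c y %/ m) k) (divn_eq (pre c y' %/ m) k).
  by rewrite er -!divnMA ![m * k]mulnC (same y y').
move=> y y' yM y'M ef; have [le|/ltnW le] := leqP (pre c y) (pre c y').
  exact: winj.
by apply/esym; apply: winj.
Qed.

End Closure.

(** * Codes of the vertices of a tree *)

Section TreeCode.
Variables (V : finType) (e : rel V).
Hypothesis e_sym : symmetric e.
Hypothesis acyclic : forall s : seq V, ucycle e s -> size s <= 2.

(* Follow two simple paths with distinct first steps up to the first vertex z
   of the second one that lies on the first one: this closes a cycle. *)
Lemma simple_path_unique x p q :
  path e x p -> path e x q -> uniq (x :: p) -> uniq (x :: q) ->
  last x p = last x q -> p = q.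
Proof.
elim: p x q => [|a p IH] x [|b q] //.
- move=> _ _ _ /= /andP[xq _] lq; case/negP: xq; rewrite {1}lq.
  exact: mem_last.
- move=> _ _ /= /andP[xp _] _ lp; case/negP: xp; rewrite -{1}lp.
  exact: mem_last.
move=> xp xq up uq lpq; have [eab|nab] := eqVneq a b.
  subst b; congr (_ :: _); move: xp xq up uq lpq.
  rewrite /= => /andP[_ ap] /andP[_ aq] /andP[_ up] /andP[_ uq].
  exact: IH.
have hq : has (mem (a :: p)) (b :: q).
  apply/hasP; exists (last x (b :: q)); first exact: (mem_last b q).
  by rewrite -lpq; apply: (mem_last a p).
have [z [q1 [q2 [eq zp nq1]]]] : exists z q1 q2,
    [/\ b :: q = q1 ++ z :: q2, z \in a :: p & ~~ has (mem (a :: p)) q1].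
  move: hq; case/split_find=> z q1 q2 zp nq1.
  by exists z, q1, q2; rewrite cat_rcons.
have [p1 [p2 ep]] : exists p1 p2, a :: p = p1 ++ z :: p2.
  by case/splitPr: zp => p1 p2; exists p1, p2.
have nq : forall t, t \in q1 -> t \notin a :: p.
  by move=> t tq; apply: contraNN nq1 => tp; apply/hasP; exists t.
have cyc : ucycle e (x :: p1 ++ z :: rev q1).
  rewrite /ucycle; apply/andP; split.
    move: xp; rewrite ep cat_path /= => /and3P[xp1 p1z _].
    rewrite rcons_cat cat_path xp1 rcons_cons /= p1z /=.
    move: xq; rewrite eq -cat_rcons cat_path => /andP[xq1 _].
    have := rev_path e x (rcons q1 z).
    rewrite last_rcons belast_rcons rev_cons => ->.
    by rewrite (eq_path (e' := e)) // => u v; rewrite e_sym.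
  move: up uq; rewrite ep eq => /= /andP[xp1 up1] /andP[xq1 uq1].
  move: xp1; rewrite mem_cat inE !negb_or => /and3P[xp1 xz _].
  move: xq1; rewrite mem_cat inE !negb_or => /and3P[xq1 _ _].
  move: up1; rewrite cat_uniq /= negb_or => /and3P[up1 /andP[zp1 _] _].
  move: uq1; rewrite cat_uniq /= negb_or => /and3P[uq1 /andP[zq1 _] _].
  rewrite mem_cat inE mem_rev !negb_or xp1 xz xq1 cat_uniq /= negb_or.
  rewrite up1 zp1 mem_rev zq1 rev_uniq uq1 /= andbT.
  apply/hasPn => t; rewrite mem_rev => tq.
  by have := nq t tq; rewrite ep mem_cat negb_or => /andP[].
(* The cycle contains [x] and [z] already, so [p1] and [q1] are empty and [a = z = b]. *)
have := acyclic cyc; rewrite /= size_cat /= size_rev addnS !ltnS leqn0.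
rewrite addn_eq0 => /andP[/nilP ep1 /nilP eq1].
move: ep eq; rewrite ep1 eq1 => -[eaz _] [ebz _].
by rewrite eaz ebz eqxx in nab.
Qed.

End TreeCode.

(* The code of a vertex lists the vertices on the path from the root, so that
   ancestors are prefixes. *)
Lemma tree_code (V : finType) (e : rel V) : is_tree e ->
  exists (root : V) (c : V -> seq nat),
  [/\ injective c, forall v i, exists u, c u = take i (c v), c root = [::]
    & forall x y, e x y ->
      (exists a, c y = rcons (c x) a) \/ (exists a, c x = rcons (c y) a)].
Proof.
case=> /card_gt0P[root _] [e_sym e_irr] e_conn acyclic.
have uniqp := simple_path_unique e_sym acyclic.
have /choice[c0 c0P] : forall y, exists p,
    [/\ path e root p, uniq (root :: p) & last root p = y].
  move=> y; have /connectP[p pp ->] := e_conn root y.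
  by case/shortenP: pp => p' pp' up' _; exists p'.
pose r (v : V) := nat_of_ord (enum_rank v).
have r_inj : injective r by move=> x y /ord_inj /enum_rank_inj.
exists root, (fun v => map r (c0 v)); split.
- move=> x y /(inj_map r_inj) exy.
  by have [_ _ <-] := c0P x; have [_ _ <-] := c0P y; rewrite exy.
- move=> v i; have [pv uv _] := c0P v.
  exists (last root (take i (c0 v))); rewrite -map_take; congr map.
  have [pu uu lu] := c0P (last root (take i (c0 v))).
  move: pv uv; rewrite -{1 2}(cat_take_drop i (c0 v)) cat_path.
  rewrite -cat_cons cat_uniq.
  by case/andP=> pt _ /and3P[ut _ _]; apply: (uniqp root).
- have [pr ur lr] := c0P root; have -> // : c0 root = [::].
  by apply: (uniqp root).
move=> x y exy; have [px ux lx] := c0P x; have [py uy ly] := c0P y.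
(* If the path to [x] visits [y], the edge closes its part after [y] into a cycle, so this part is a
   single step and [y] is the parent of [x]. Otherwise the path to [x] extends to [y]. *)
have [yx|nyx] := boolP (y \in root :: c0 x).
  right; have [p1 [p2 [ep lp1]]] :
      exists p1 p2, c0 x = p1 ++ p2 /\ last root p1 = y.
    by case/splitPl: yx => p1 p2 lp; exists p1, p2.
  move: px ux lx; rewrite ep cat_path -cat_cons cat_uniq last_cat lp1.
  case/andP=> pp1 pp2 /and3P[up1 dis up2] lp2.
  have ep1 : c0 y = p1 by apply: (uniqp root); rewrite ?lp1.
  have yp2 : y \notin p2.
    apply: contra dis => yp2; apply/hasP; exists y => //=.
    by rewrite -lp1 mem_last.
  have : ucycle e (y :: p2).
    by rewrite /ucycle /= yp2 up2 rcons_path pp2 lp2 exy.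
  move/acyclic; rewrite ep1; case: p2 {ep pp2 up2 dis yp2} lp2 => [|z [|//]] /=.
    by move=> eyx; rewrite eyx e_irr in exy.
  by move=> -> _; exists (r x); rewrite map_cat /= cats1.
left; exists (r y); rewrite -map_rcons; congr map; apply: (uniqp root) => //.
- by rewrite rcons_path px lx.
- by rewrite -rcons_cons rcons_uniq nyx.
by rewrite ly last_rcons.
Qed.

(** * Encoding and algorithm *)

(** Bits come in pairs: the first tells a digit from a mark, the second is the digit, lowest first,
    or tells a number mark from a row mark. Decoding thus needs no knowledge of [L]. *)
Fixpoint encode_digits L x : bits :=
  if L is L'.+1 then [:: true, odd x & encode_digits L' x./2] else [::].

Definition encode_nat L x : bits := [:: false, false & encode_digits L x].

Definition encode_row L r : bits :=
  [:: false, true & flatten [seq encode_nat L x | x <- r]].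

Definition encode L rows : bits := flatten [seq encode_row L r | r <- rows].

(* The state holds the number, the row and the rows that are being read, from
   right to left. *)
Fixpoint parse (s : bits) : nat * seq nat * seq (seq nat) :=
  if s is t :: b :: s' then
    let: (x, r, rows) := parse s' in
    if t then (b + x.*2, r, rows)
    else if b then (0, [::], r :: rows) else (0, x :: r, rows)
  else (0, [::], [::]).

Definition decode s := (parse s).2.

Lemma parse_digits L x s r rows : x < 2 ^ L -> parse s = (0, r, rows) ->
  parse (encode_digits L x ++ s) = (x, r, rows).
Proof.
elim: L x => [|L IH] x; first by rewrite expn0 ltnS leqn0 => /eqP ->.
rewrite expnS mul2n => xL /IH h; rewrite /= h ?odd_double_half //.
by rewrite -ltn_double -[X in _ < X]add0n; apply: leq_ltn_trans xL;
  rewrite -[leqRHS]odd_double_half leq_addl.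
Qed.

Lemma parse_row L x s r rows : all (fun x => x < 2 ^ L) x ->
  parse s = (0, r, rows) ->
  parse (flatten [seq encode_nat L y | y <- x] ++ s) = (0, x ++ r, rows).
Proof.
elim: x => [|y x IH] //= /andP[yL xL] hs.
by rewrite -catA (parse_digits yL (IH xL hs)).
Qed.

Lemma encodeK L rows : all (all (fun x => x < 2 ^ L)) rows ->
  decode (encode L rows) = rows.
Proof.
move=> h; rewrite /decode.
suff -> : parse (encode L rows) = (0, [::], rows) by [].
elim: rows h => [|r rows IH] //= /andP[rL /IH h].
by rewrite /encode /= (parse_row rL h) cats0.
Qed.

Lemma size_encode_nat L x : size (encode_nat L x) = L.+1.*2.
Proof. by rewrite /=; elim: L x => [|L IH] x //=; rewrite IH. Qed.

Lemma size_encode_nats L r :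
  size (flatten [seq encode_nat L x | x <- r]) = L.+1.*2 * size r.
Proof.
elim: r => [|x r IH]; first by rewrite muln0.
by rewrite mulnS -IH -(size_encode_nat L x) -size_cat.
Qed.

Lemma size_encode L rows :
  size (encode L rows) <= L.+1.*2 * (size rows + sumn (map size rows)).
Proof.
elim: rows => [|r rows IH] //.
have -> : encode L (r :: rows) = encode_row L r ++ encode L rows by [].
rewrite size_cat /= size_encode_nats.
rewrite [X in _ <= _ * X](_ : _ =
  1 + size r + (size rows + sumn (map size rows))).
  rewrite mulnDr; apply: leq_add IH.
  by rewrite mulnDr muln1 -add2n leq_add2r.
by rewrite /= add1n !addSn addnCA.
Qed.

Lemma find_iota (p : pred nat) n j : j < n -> p j ->
  (forall i, i < j -> ~~ p i) -> find p (iota 0 n) = j.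
Proof.
move=> jn pj h; have -> : n = j + (n - j).-1.+1.
  by rewrite prednK ?subn_gt0 // subnKC // ltnW.
rewrite iotaD find_cat /= add0n pj addn0 size_iota ifN //.
by apply/hasPn => i; rewrite mem_iota => /h.
Qed.

(* A decoded table or label is [num] :: keys :: ports :: levels, where num is
   the preorder number of the vertex u, keys and ports list the numbers of the
   peers of u and the ports of u towards them, and the i-th level is
   [top; gate; p; bot; last; q] for the i-th skeleton: the vertices by their
   preorder numbers, and the ports p, q from u to gate and bot in tables, from
   gate and bot to u in labels. *)
Definition rec_num (r : seq (seq nat)) := nth 0 (nth [::] r 0) 0.
Definition rec_keys (r : seq (seq nat)) := nth [::] r 1.
Definition rec_ports (r : seq (seq nat)) := nth [::] r 2.
Definition rec_levels (r : seq (seq nat)) := drop 3 r.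

Definition choose_exit (l : seq nat) target : nat * nat :=
  if nth 0 l 3 <= target <= nth 0 l 4 then (nth 0 l 3, nth 0 l 5)
  else (nth 0 l 1, nth 0 l 2).

Definition split_level (r r' : seq (seq nat)) :=
  find (fun i => nth 0 (nth [::] (rec_levels r) i) 0
              != nth 0 (nth [::] (rec_levels r') i) 0)
    (iota 0 (size (rec_levels r))).

(** The tests run backwards from the target: when some stops coincide, the last role wins and the
    empty hops are skipped. *)
Definition next_port (here source target : seq (seq nat)) : option nat :=
  let i := split_level source target in
  let x := choose_exit (nth [::] (rec_levels source) i) (rec_num target) in
  let y := choose_exit (nth [::] (rec_levels target) i) (rec_num source) in
  if rec_num here == rec_num target then None
  else if rec_num here == y.1 then Some y.2
  else if rec_num here == x.1 then
    Some (nth 0 (rec_ports here) (index y.1 (rec_keys here)))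
  else Some x.2.

(** The header carries the whole table of the source, so that every vertex on the way can recompute
    both stops. *)
Definition tree_routing := RoutingAlgorithm (fun table _ => table)
  (fun table h =>
     next_port (decode table) (decode (extra_info h)) (decode (dest_label h))).

(** * Tables and labels *)

Section Destutter.
Variable T : eqType.

Fixpoint destutter (x : T) s :=
  if s is y :: s' then
    if y == x then destutter x s' else y :: destutter y s'
  else [::].

Lemma size_destutter x s : size (destutter x s) <= size s.
Proof.
elim: s x => [|y s IH] x //=; case: ifP => _ /=; last by rewrite ltnS.
exact: leq_trans (IH x) (leqnSn _).
Qed.

Lemma last_destutter x s : last x (destutter x s) = last x s.
Proof. by elim: s x => [|y s IH] x //=; case: eqP => [->|_] /=. Qed.

Lemma path_destutter (r : rel T) x s :
  path (fun x y => (x == y) || r x y) x s -> path r x (destutter x s).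
Proof.
elim: s x => [|y s IH] x //= /andP[xy /IH ys].
by move: xy; rewrite eq_sym; case: eqP => [<-|_] //= ->.
Qed.

End Destutter.

Section Scheme.
Variables (V : finType) (c : V -> seq nat) (root : V).
Hypothesis c_inj : injective c.
Hypothesis c_take : forall v i, exists u, c u = take i (c v).
Hypothesis c_root : c root = [::].

Variables (d : nat) (X : nat -> {set V}).
Hypothesis X_skel : forall i, skeleton c root (X i).
Hypothesis X_first : X 0 = [set root].
Hypothesis X_last : X d = [set: V].
Hypothesis X_mono : forall i, {subset X i <= X i.+1}.

Variable port : V -> V -> nat.
Hypothesis port_ok : port_assignment (fun u v : V => u != v) port.

Local Notation top_ i := (top c root (X i)).
Local Notation exit_ i := (exit c root (X i)).

(* The value at u = v is a dummy, stored when u is its own gate or bot. *)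
Definition link u v := if u == v then 0 else port u v.

(* When the component has no bot, the numbers 1 and 0 encode an empty interval,
   so that [choose_exit] selects the gate. *)
Definition level (f : V -> nat) u i : seq nat :=
  let b := bot c root (X i) u in
  [:: pre c (top_ i u); pre c (gate c root (X i) u); f (gate c root (X i) u);
      oapp (pre c) 1 b; oapp (lastpre c) 0 b; oapp f 0 b].

Definition birth u := find (fun i => u \in X i) (iota 0 d.+1).

(** Ports are stored for the level where [u] appears only: at later levels [u] is a component by
    itself. The root, alone in [X 0], has no peers. *)
Definition peers u :=
  if birth u is i.+1 then enum (X i.+1 :&: component c root (X i) u) else [::].

Definition table_rows u :=
  [:: [:: pre c u], map (pre c) (peers u), map (link u) (peers u)
    & map (level (link u) u) (iota 0 d.+1)].

Definition label_rows v :=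
  [:: [:: pre c v], [::], [::] & map (level (link^~ v) v) (iota 0 d.+1)].

Lemma table_levels u :
  rec_levels (table_rows u) = map (level (link u) u) (iota 0 d.+1).
Proof. by rewrite /rec_levels /= ?drop0. Qed.

Lemma label_levels v :
  rec_levels (label_rows v) = map (level (link^~ v) v) (iota 0 d.+1).
Proof. by rewrite /rec_levels /= ?drop0. Qed.

Lemma choose_exit_level f u i t :
  choose_exit (level f u i) (pre c t) = (pre c (exit_ i u t), f (exit_ i u t)).
Proof.
rewrite /choose_exit /level /exit /=; case: (bot _ _ _ _) => [b|] /=.
  by rewrite -anc_interval; case: ifP.
by rewrite leqn0; case: (pre c t).
Qed.

Lemma nth_levels f u i :
  i <= d -> nth [::] (map (level f u) (iota 0 d.+1)) i = level f u i.
Proof. by move=> id; rewrite (nth_map 0) ?size_iota // nth_iota. Qed.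

Lemma split_levelP u v : u != v ->
  exists i, [/\ i <= d, split_level (table_rows u) (label_rows v) = i,
    top_ i u != top_ i v & forall j, j < i -> top_ j u = top_ j v].
Proof.
move=> nuv; have ex : exists i, top_ i u != top_ i v.
  by exists d; rewrite !(top_id c_inj c_take c_root (X_skel d)) ?X_last ?inE.
case: (ex_minnP ex) => i ni min_i; have id : i <= d.
  apply: min_i.
  by rewrite !(top_id c_inj c_take c_root (X_skel d)) ?X_last ?inE.
exists i; split=> //; last first.
  by move=> j ji; apply/eqP; apply: contraLR ji => /min_i; rewrite -leqNgt.
rewrite /split_level table_levels label_levels.
have lev j : j <= d ->
    (nth 0 (nth [::] (map (level (link u) u) (iota 0 d.+1)) j) 0
      != nth 0 (nth [::] (map (level (link^~ v) v) (iota 0 d.+1)) j) 0)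
    = (top_ j u != top_ j v).
  by move=> jd; rewrite !nth_levels //= (inj_eq (pre_inj c_inj)).
rewrite size_map size_iota; apply: find_iota; rewrite ?lev //.
move=> j ji; rewrite lev ?(leq_trans (ltnW ji)) //.
by apply: contraL ji => /min_i; rewrite -leqNgt.
Qed.

Lemma X_monoW i j : i <= j -> {subset X i <= X j}.
Proof.
move=> /subnKC <-; elim: (j - i) => [|k IH] x xi; first by rewrite addn0.
by rewrite addnS; apply: X_mono; apply: IH.
Qed.

Lemma birthE u i : i < d -> u \notin X i -> u \in X i.+1 -> birth u = i.+1.
Proof.
move=> id nu u'; apply: find_iota => // j; rewrite ltnS => ji.
by apply: contra nu; apply: X_monoW.
Qed.

(** At the level before [i], [u] and [v] share a component, which contains their path, hence [x] and
    [y]. A vertex [x] of the earlier skeleton would be alone there, against [u != v]; so [x] appears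
    at level [i]. *)
Lemma mem_peers i u v x y : i <= d -> u != v ->
  (forall j, j < i -> top_ j u = top_ j v) ->
  x \in X i -> y \in X i -> between c u x v -> between c u y v ->
  x != y -> y \in peers x.
Proof.
move=> + nuv; case: i => [|i] id same.
  by rewrite X_first !inE => /eqP -> /eqP ->; rewrite eqxx.
move=> xi yi ux uy _; have e := same i (ltnSn i).
have ex := between_exit_top c_inj c_take c_root (X_skel i) nuv e ux.
have ey := between_exit_top c_inj c_take c_root (X_skel i) nuv e uy.
have nx : x \notin X i.
  apply: contra nuv => xX.
  have eu := top_mem_eq c_inj c_take c_root (X_skel i) xX.
  by rewrite -(eu u ex) -(eu v) // ex.
by rewrite /peers (birthE id nx xi) mem_enum !inE yi ey ex eqxx.
Qed.

Lemma linkE u v : u != v -> link u v = port u v.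
Proof. by rewrite /link => /negbTE ->. Qed.

Lemma next_port_target s v :
  next_port (table_rows v) (table_rows s) (label_rows v) = None.
Proof. by rewrite /next_port /rec_num /= eqxx. Qed.

Lemma next_portP s v : s != v -> exists x y,
  let h w := next_port (table_rows w) (table_rows s) (label_rows v) in
  [/\ between c s y v, between c s x y, s != x -> h s = Some (port s x),
      x != y -> h x = Some (port x y) & y != v -> h y = Some (port y v)].
Proof.
move=> nsv; have [i [id ei ni mini]] := split_levelP nsv.
pose x := exit_ i s v; pose y := exit_ i v s; exists x, y.
have xX : x \in X i := exit_mem c_root (X_skel i) s v.
have yX : y \in X i := exit_mem c_root (X_skel i) v s.
have exit_id' := exit_id c_inj c_take c_root (X_skel i).
have exit_between' := exit_between c_inj c_take c_root (X_skel i).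
have bx : between c s x v by apply: exit_between'.
have by_ : between c s y v.
  by rewrite (between_sym c_inj c_take); apply: exit_between'; rewrite eq_sym.
have hE w : next_port (table_rows w) (table_rows s) (label_rows v) =
    if w == v then None else if w == y then Some (link y v)
    else if w == x then
      Some (nth 0 (map (link w) (peers w))
                  (index (pre c y) (map (pre c) (peers w))))
    else Some (link s x).
  rewrite /next_port ei table_levels label_levels !nth_levels //.
  rewrite /rec_num -/(pre c v) !choose_exit_level /=.
  by rewrite !(inj_eq (pre_inj c_inj)).
split=> // [|nsx|nxy|nyv].
(* By [exit_exit], [x] is also the exit of [s] towards [y]. If [y = s], then [s] is in [X i] and is
   its own exit. *)
- have [ys|nys] := eqVneq y s.
    have xs : x = s by apply: exit_id'; rewrite -ys.
    by rewrite xs between_refll.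
  have <- : exit_ i s y = x by apply: exit_exit.
  apply: exit_between'; apply: contraNneq nys => e.
  by rewrite (top_mem_eq c_inj c_take c_root (X_skel i) yX (esym e)).
- have nsy : s != y.
    by apply: contraNneq nsx => sy; rewrite [x]exit_id' // sy.
  by rewrite hE (negbTE nsv) (negbTE nsy) (negbTE nsx) linkE.
- have nxv : x != v.
    by apply: contraNneq nxy => xv; rewrite [y]exit_id' -?xv.
  rewrite hE (negbTE nxv) (negbTE nxy) eqxx.
  have yP : y \in peers x by apply: (mem_peers id nsv mini).
  rewrite (index_map (pre_inj c_inj)) (nth_map s) ?index_mem //.
  by rewrite nth_index // linkE.
by rewrite hE (negbTE nyv) eqxx linkE.
Qed.

(** * Sizes of tables and labels *)

Variable L : nat.
Hypothesis V_small : #|V| < 2 ^ L.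

Lemma link_small u v : link u v < 2 ^ L.
Proof.
apply: leq_ltn_trans V_small; rewrite /link; case: eqVneq => // nuv.
by have [_ /(_ v nuv) /andP[_ /leq_trans]] := port_ok u; apply; apply: max_card.
Qed.

Lemma pre_small u : pre c u < 2 ^ L.
Proof. exact: ltn_trans (pre_lt c u (erefl _)) V_small. Qed.

Lemma level_small f u i : (forall v, f v < 2 ^ L) ->
  all (fun x => x < 2 ^ L) (level f u i).
Proof.
move=> fs; rewrite /= !pre_small fs /=; case: (bot _ _ _ _) => [b|] /=.
  rewrite pre_small fs !andbT /=; apply: leq_ltn_trans (_ : #|V|.-1 < _).
    apply/bigmax_leqP => y _; rewrite -ltnS prednK ?pre_lt //.
    by apply/card_gt0P; exists u.
  by apply: leq_ltn_trans V_small; apply: leq_pred.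
rewrite expn_gt0 /= andbT; apply: leq_ltn_trans V_small.
by apply/card_gt0P; exists u.
Qed.

Lemma table_small u : all (all (fun x => x < 2 ^ L)) (table_rows u).
Proof.
rewrite [all _ _]/= pre_small !all_map /=; apply/and3P; split.
- by apply/allP => v _; apply: pre_small.
- by apply/allP => v _; apply: link_small.
by apply/andP; split; [|apply/allP => i _]; apply: level_small => v;
  apply: link_small.
Qed.

Lemma label_small v : all (all (fun x => x < 2 ^ L)) (label_rows v).
Proof.
rewrite [all _ _]/= pre_small !all_map /=.
by apply/andP; split; [|apply/allP => i _]; apply: level_small => u;
  apply: link_small.
Qed.

Variable K : nat.
Hypothesis X_card : forall i a, a \notin X i ->
  #|X i.+1 :&: component c root (X i) a| <= K.

Lemma size_peers u : size (peers u) <= K.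
Proof.
rewrite /peers; case eb: (birth u) => [|i] //; rewrite -cardE X_card //.
have : i < birth u by rewrite eb.
move=> lt; have /negbT := before_find 0 lt; rewrite nth_iota //.
apply: leq_trans lt _; apply: leq_trans (find_size _ _) _.
by rewrite size_iota.
Qed.

Lemma size_levels f u s :
  sumn (map size (map (level f u) s)) = 6 * size s.
Proof. by elim: s => //= i s ->; rewrite mulnS. Qed.

(** Table and label each have [d + 4] rows and [1 + 6 * (d + 1)] numbers, and the table has at most
    [2 * K] more for the peers; each row or number costs at most [2 * (L + 1)] bits. *)
Lemma size_table_label u :
  size (encode L (table_rows u)) + size (encode L (label_rows u))
    <= L.+1.*2 * (14 * d + K.*2 + 22).
Proof.
apply: leq_trans (leq_add (size_encode _ _) (size_encode _ _)) _.
rewrite -mulnDr leq_mul2l; apply/orP; right.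
have hK := size_peers u.
rewrite /table_rows /label_rows.
rewrite ![size (_ :: _)]/= ![map size (_ :: _)]/= ![sumn (_ :: _)]/=.
rewrite !size_levels !size_map !size_iota; lia.
Qed.

Lemma routed_destutter s v : exists x y,
  [/\ between c s y v, between c s x y &
   routed_path tree_routing (fun u v : V => u != v) port
     (fun u => encode L (table_rows u)) (fun u => encode L (label_rows u))
     s v (destutter s [:: x; y; v])].
Proof.
have fwd h : forward tree_routing (encode L (table_rows h))
    (Header (encode L (label_rows v)) (make_extra tree_routing
      (encode L (table_rows s)) (encode L (label_rows v)))) =
    next_port (table_rows h) (table_rows s) (label_rows v).
  by rewrite /= !encodeK ?table_small ?label_small.
have [evs|nsv] := eqVneq v s.
  rewrite evs in fwd *; exists s, s.
  split; rewrite ?between_refll //= eqxx; split=> //.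
  by rewrite fwd next_port_target.
rewrite eq_sym in nsv.
have [x [y [syv sxy hs hx hy]]] := next_portP nsv.
exists x, y; split=> //; split.
- apply: path_destutter; apply/and4P; split; rewrite ?fwd //.
  + by case: eqVneq => //= /hs ->; rewrite eqxx.
  + by case: eqVneq => //= /hx ->; rewrite eqxx.
  by case: eqVneq => //= /hy ->; rewrite eqxx.
- by rewrite last_destutter.
by rewrite fwd next_port_target.
Qed.

End Scheme.

(** * Shortest-path distance *)

Section Metric.
Local Open Scope classical_set_scope.
Local Open Scope ring_scope.
Variables (R : realType) (V : finType) (e : rel V) (w : V -> V -> R).
Hypothesis w_edge : edge_weighting e w.
Hypothesis e_conn : forall x y, connect e x y.

Local Notation dist := (sp_metric e w).

Lemma walk_length_cat (f : V -> V -> R) u p q :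
  walk_length f u (p ++ q) = walk_length f u p + walk_length f (last u p) q.
Proof. by rewrite /walk_length pairmap_cat big_cat. Qed.

Lemma walk_length_cons (f : V -> V -> R) u x p :
  walk_length f u (x :: p) = f u x + walk_length f x p.
Proof. by rewrite /walk_length /= big_cons. Qed.

Lemma walk_length_nil (f : V -> V -> R) u : walk_length f u [::] = 0.
Proof. by rewrite /walk_length big_nil. Qed.

Lemma walk_length_ge0 u p : path e u p -> 0 <= walk_length w u p.
Proof.
elim: p u => [|x p IH] u /=; first by rewrite walk_length_nil.
case/andP=> /w_edge[/ltW ux _] /IH px.
by rewrite walk_length_cons addr_ge0.
Qed.

Lemma sp_metric_le u p : path e u p -> dist u (last u p) <= walk_length w u p.
Proof.
move=> up; apply: ge_inf; last by exists p.
by exists 0 => _ [q [uq _] <-]; apply: walk_length_ge0.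
Qed.

Lemma sp_metric_ge u v m :
  (forall p, path e u p -> last u p = v -> m <= walk_length w u p) ->
  m <= dist u v.
Proof.
move=> h; apply: lb_le_inf; last by move=> _ [q [uq ?] <-]; apply: h.
by have /connectP[p up ->] := e_conn u v; exists (walk_length w u p), p.
Qed.

Lemma sp_metric_self u : dist u u = 0.
Proof.
apply/le_anti/andP; split.
  by have := @sp_metric_le u [::] isT; rewrite walk_length_nil.
by apply: sp_metric_ge => p up _; apply: walk_length_ge0.
Qed.

(** Each walk from [u] to [v] can be cut at [x]. *)
Lemma sp_metric_split u x v :
  (forall p, path e u p -> last u p = v -> x \in u :: p) ->
  dist u x + dist x v <= dist u v.
Proof.
move=> sep; apply: sp_metric_ge => p up lp.
have [p1 [p2 [ep lp1]]] : exists p1 p2, p = p1 ++ p2 /\ last u p1 = x.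
  by case/splitPl: (sep p up lp) => p1 p2 lp1; exists p1, p2.
move: up lp; rewrite ep cat_path last_cat lp1 => /andP[up1 xp2] <-.
rewrite walk_length_cat lp1 lerD ?sp_metric_le // -{1}lp1.
exact: sp_metric_le.
Qed.

Lemma walk_length_destutter x s :
  walk_length dist x (destutter x s) = walk_length dist x s.
Proof.
elim: s x => [|y s IH] x //=; case: eqP => [->|_].
  by rewrite walk_length_cons sp_metric_self add0r.
by rewrite !walk_length_cons IH.
Qed.

End Metric.

(** * Number of bits *)

Definition num_width n := (trunc_log 2 n).+1.
(** The logarithm of the parameter [k]: halving makes [k] at most the square root of [num_width n]
    for large [n], and the maximum keeps it positive for small [n]. *)
Definition branching n := maxn 1 (trunc_log 2 (num_width n))./2.
Definition num_levels n := (num_width n %/ branching n).+1.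
Definition bit_bound n :=
  (num_width n).+1.*2 *
  (14 * num_levels n + ((2 ^ branching n).*2.+1).*2.*2 + 22).

Lemma num_width_gt n : n < 2 ^ num_width n.
Proof. exact: trunc_log_ltn. Qed.

Lemma leq_num_levels n : num_width n <= branching n * num_levels n.
Proof.
rewrite mulnC; apply/ltnW/ltn_ceil.
by rewrite /branching leq_max.
Qed.

Lemma branchingE n : 16 <= n ->
  [/\ 0 < branching n, 4 ^ branching n <= num_width n
    & trunc_log 2 (num_width n) <= (branching n).*2.+1].
Proof.
move=> n16; have w5 : 4 <= num_width n.
  by rewrite /num_width ltnS; apply: trunc_log_max => //; apply: leq_trans n16.
have t2 : 2 <= trunc_log 2 (num_width n) by apply: trunc_log_max.
have eb : branching n = (trunc_log 2 (num_width n))./2.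
  by apply/maxn_idPr; rewrite half_gt0.
split; rewrite eb ?half_gt0 //.
  apply: leq_trans (trunc_logP (isT : 1 < 2) (ltn0Sn _)).
  rewrite (_ : 4 = 2 ^ 2)%N // -expnM leq_exp2l // mul2n.
  by rewrite -[leqRHS]odd_double_half leq_addl.
by rewrite -[leqLHS]odd_double_half; case: odd; rewrite ?add0n // leqnSn.
Qed.

(** Write [h] for [branching n]. The levels contribute [h * (L %/ h) <= L], the peers
    [h * 2 ^ h <= 4 ^ h <= L]. *)
Lemma bit_bound_le n : 16 <= n ->
  branching n * bit_bound n <= 248 * num_width n ^ 2.
Proof.
case/branchingE; rewrite /bit_bound /num_levels.
move: (branching n) (num_width n) => h L h0 hL _.
have hh : h < 2 ^ h by apply: ltn_expl.
have e4 : 4 ^ h = 2 ^ h * 2 ^ h by rewrite -expnMn.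
have hk : h * 2 ^ h <= L.
  by apply: leq_trans hL; rewrite e4 leq_mul2r ltnW ?orbT.
have h1 : h <= L by apply: leq_trans hk; rewrite leq_pmulr // expn_gt0.
have hd : h * (L %/ h) <= L by rewrite mulnC leq_divM.
move: (L %/ h) (2 ^ h) hd hk => q k hd hk.
(* The three terms are at most [28 * L], [12 * L] and [22 * L]; the factor [2 * (L + 1) <= 4 * L]
   then gives 248. *)
have step : h * (14 * q.+1 + k.*2.+1.*2.*2 + 22) <= 62 * L by lia.
have L0 : 0 < L by apply: leq_trans h0 h1.
rewrite mulnCA; apply: leq_trans (leq_mul (leqnn _) step) _.
by rewrite -mulnn; nia.
Qed.

Section Asymptotics.
Local Open Scope classical_set_scope.
Local Open Scope ring_scope.
Variable R : realType.

Lemma ln2_bounds : 2^-1 <= ln (2 : R) <= 1.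
Proof.
apply/andP; split.
  have := @le_ln1Dx R (- 2^-1).
  rewrite (_ : 1 + - 2^-1 = 2^-1 :> R); last by lra.
  by rewrite lnV ?posrE // lerN2; apply; lra.
by have := @le_ln1Dx R 1; rewrite (_ : 1 + 1 = 2 :> R) //; apply; lra.
Qed.

Lemma bit_bound_bigO : (fun n : nat => (bit_bound n)%:R : R) =O_\oo
  (fun n : nat => ln (n%:R : R) ^+ 2 / ln (ln (n%:R : R))).
Proof.
(* This is 4 * 248 * 9, from [ln x <= 4 * h], [h * b <= 248 * L ^ 2] and [L <= 3 * x]. *)
apply/eqO_exP; exists 8928; first by lra.
near=> n; have n16 : (16 <= n)%N by near: n; exists 16.
have [l2 u2] := andP ln2_bounds.
have n0 : 0 < n%:R :> R by rewrite ltr0n (leq_trans _ n16).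
have [h0 hL hT] := branchingE n16; have hb := bit_bound_le n16.
set L := num_width n in hL hT hb; set h := branching n in h0 hL hT hb.
set x : R := ln n%:R; set b := bit_bound n in hb *.
have lnX2 m : ln (2 ^+ m : R) = m%:R * ln 2 by rewrite lnXn // mulr_natl.
have x2 : 2 <= x.
  have : ln (2 ^+ 4 : R) <= x.
    by rewrite ler_ln ?posrE // -natrX ler_nat.
  rewrite lnX2 => h4; lra.
have xL : x <= L%:R.
  have : x <= ln (2 ^+ L : R).
    by rewrite ler_ln ?posrE ?exprn_gt0 // -natrX ler_nat ltnW ?num_width_gt.
  by rewrite lnX2 => /le_trans; apply; rewrite ler_piMr.
have Lx : L%:R <= 3 * x.
  have : ln (2 ^+ L.-1 : R) <= x.
    rewrite ler_ln ?posrE ?exprn_gt0 // -natrX ler_nat.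
    by apply: trunc_logP => //; apply: leq_trans n16.
  rewrite lnX2 /L /num_width /= => h1.
  rewrite -natr1; have : (trunc_log 2 n)%:R * 2^-1 <= x.
    by apply: le_trans h1; rewrite ler_wpM2l.
  move=> h2; lra.
have lx0 : 0 < ln x by rewrite ln_gt0; lra.
have lxh : ln x <= 4 * h%:R.
  have : ln x <= ln (2 ^+ (trunc_log 2 L).+1 : R).
    rewrite ler_ln ?posrE ?exprn_gt0 //; last lra.
    by apply: le_trans xL _; rewrite -natrX ler_nat ltnW ?trunc_log_ltn.
  rewrite lnX2 => /le_trans; apply.
  apply: (@le_trans _ _ (trunc_log 2 L).+1%:R); first by rewrite ler_piMr.
  by rewrite -natrM ler_nat; lia.
rewrite ger0_norm // ger0_norm; last by rewrite divr_ge0 ?sqr_ge0 ?ltW.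
rewrite mulrA ler_pdivlMr //.
have hbR : h%:R * b%:R <= 248 * L%:R ^+ 2 :> R.
  by rewrite -natrX -!natrM ler_nat.
have b0 : 0 <= b%:R :> R by [].
have L0 : 0 <= L%:R :> R by [].
have bl : b%:R * ln x <= 4 * (h%:R * b%:R).
  by rewrite mulrA [leRHS]mulrC ler_wpM2l.
have LL : L%:R ^+ 2 <= 9 * x ^+ 2.
  have -> : 9 * x ^+ 2 = (3 * x) ^+ 2 by ring.
  by rewrite lerXn2r ?nnegrE //; lra.
lra.
Unshelve. all: by end_near. Qed.

End Asymptotics.

(** * The skeletons of a tree *)

Section Skeletons.
Variables (V : finType) (c : V -> seq nat) (root : V).
Hypothesis c_inj : injective c.
Hypothesis c_take : forall v i, exists u, c u = take i (c v).
Hypothesis c_root : c root = [::].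

Variables (k d : nat).
Hypothesis k_gt0 : 0 < k.
Hypothesis V_small : #|V| <= k ^ d.

Definition skeletons i := lca_closure c (multiples c (k ^ (d - i))).

Lemma pre_root : pre c root = 0.
Proof.
have [|v v0] := pre_surj c_inj (_ : 0 < #|V|).
  by apply/card_gt0P; exists root.
by apply/eqP; rewrite -leqn0 -v0 anc_pre // anc_root.
Qed.

Lemma skeletons_skeleton i : skeleton c root (skeletons i).
Proof. by apply: lca_closure_skeleton => //; rewrite inE pre_root dvdn0. Qed.

(** Preorder numbers are less than [k ^ d], so 0 is the only multiple among them. *)
Lemma skeletons_first : skeletons 0 = [set root].
Proof.
have m0 y : y \in multiples c (k ^ (d - 0)) -> y = root.
  rewrite inE subn0 => /dvdn_leq h; apply: (pre_inj c_inj); rewrite pre_root.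
  apply/eqP; rewrite -leqn0 leqNgt; apply/negP => /h.
  by rewrite leqNgt (leq_trans _ V_small) // pre_lt.
apply/setP => x; rewrite inE; apply/imset2P/eqP => [[y z /m0 -> /m0 -> ->]|->].
  exact: lcaxx.
by exists root root; rewrite ?inE ?pre_root ?dvdn0 // lcaxx.
Qed.

Lemma skeletons_last i : d <= i -> skeletons i = [set: V].
Proof.
move=> di; apply/setP => x; rewrite [RHS]inE.
by apply: sub_lca_closure => //; rewrite inE (eqP di) expn0 dvd1n.
Qed.

Lemma skeletons_mono i : {subset skeletons i <= skeletons i.+1}.
Proof.
apply: lca_closureS; apply/fintype.subsetP => x; rewrite !inE.
by apply: dvdn_trans; apply: dvdn_exp2l; rewrite leq_sub2l.
Qed.

Lemma card_skeletons i a : a \notin skeletons i ->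
  #|skeletons i.+1 :&: component c root (skeletons i) a| <= (k.*2.+1).*2.
Proof.
move=> ai; have id : i < d.
  by rewrite ltnNge; apply: contra ai => /skeletons_last ->; rewrite inE.
have sk := skeletons_skeleton i.
apply: leq_trans (card_closure_component c_inj c_take c_root sk ai _) _.
rewrite leq_double ltnS.
apply: (card_multiples_component c_inj c_take c_root sk ai k_gt0).
rewrite -expnS -subSn // subSS; apply/fintype.subsetP.
exact: sub_lca_closure.
Qed.

End Skeletons.

(** * Assembling the scheme for an arbitrary tree *)

Local Open Scope classical_set_scope.
Local Open Scope ring_scope.

Theorem theorem1p8 (R : realType) :
  exists (A : routing_algorithm) (b : nat -> nat),
    (fun n : nat => (b n)%:R : R) =O_\oo
      (fun n : nat => ln (n%:R : R) ^+ 2 / ln (ln (n%:R : R))) /\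
    forall (n : nat) (V : finType) (e : rel V) (w : V -> V -> R),
      #|V| = n -> is_tree e -> edge_weighting e w ->
      fixed_port_routing A (sp_metric e w) 3 1 (b n).
Proof.
exists tree_routing, bit_bound; split; first exact: bit_bound_bigO.
move=> n V e w Vn tree_e w_e; exists (fun u v : V => u != v).
  by split=> [u v|u]; rewrite ?eqxx // eq_sym.
move=> port port_ok; have [_ _ e_conn _] := tree_e.
have [root [c [c_inj c_take c_root c_edge]]] := tree_code tree_e.
pose L := num_width n; pose d := num_levels n; pose k := (2 ^ branching n)%N.
have VL : (#|V| < 2 ^ L)%N by rewrite Vn num_width_gt.
have k0 : (0 < k)%N by rewrite expn_gt0.
have Vk : (#|V| <= k ^ d)%N.
  apply: ltnW; apply: (leq_trans VL).
  by rewrite -expnM leq_exp2l ?leq_num_levels.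
pose X := skeletons c k d.
have X_skel := skeletons_skeleton c_inj c_take c_root k d.
exists (fun u => encode L (table_rows c root d X port u)).
exists (fun v => encode L (label_rows c root d X port v)); split.
  move=> u; apply: (size_table_label d port VL) => i a.
  exact: (card_skeletons c_inj c_take c_root k0).
move=> s v.
have [x [y [syv sxy route]]] := routed_destutter c_inj c_take c_root X_skel
  (skeletons_first c_inj c_take c_root Vk)
  (skeletons_last c_inj c_take k (leqnn d))
  (@skeletons_mono V c k d) port_ok VL s v.
exists (destutter s [:: x; y; v]); split=> //.
  exact: (size_destutter s [:: x; y; v]).
rewrite mul1r walk_length_destutter // !walk_length_cons walk_length_nil addr0.
have split_dist a t b : between c a t b ->
    sp_metric e w a t + sp_metric e w t b <= sp_metric e w a b.
  move=> atb; apply: sp_metric_split => // p ap eb.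
  by apply: (between_walk c_inj c_take c_edge ap); rewrite eb.
(* The distance from [s] to [v] splits at [y], then the one from [s] to [y] splits at [x]. *)
rewrite addrA; apply: le_trans (split_dist s y v syv).
by rewrite lerD2r split_dist.
Qed.
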